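(* Let $(P,\leq,0,1)$ be a bounded poset satisfying the Ascending Chain Condition, and let $\Phi,\Psi$ be equivalence relations on $2^P\setminus\{\emptyset\}$, each satisfying the substitution property with respect to $\odot$ and with respect to $\rightarrow$. If $[1]\Phi=[1]\Psi$, then $\Phi\cap P^2=\Psi\cap P^2$.
   Context: A poset is bounded if it has a bottom element $0$ and a top element $1$. The Ascending Chain Condition (ACC) says that there is no infinite strictly ascending chain. Singletons are identified with their unique element, i.e. $x$ is written for $\{x\}$; thus $\Phi\cap P^2$ is the relation $\{(a,b)\in P^2\mid(\{a\},\{b\})\in\Phi\}$, the restriction of $\Phi$ to $P$. $[1]\Phi$ denotes the $\Phi$-class of $\{1\}$. For $a,b\in P$ and subsets $A,B\subseteq P$: $\operatorname{Max}A$ is the set of all maximal elements of $A$; $L(a,b):=\{x\in P\mid x\leq a\text{ and }x\leq b\}$; $\Lambda(A,B):=\bigcup_{x\in A,\,y\in B}L(x,y)$; $A\leq_1B$ means that for every $x\in A$ there exists $y\in B$ with $x\leq y$. For non-empty subsets $A,B$ of $P$ define $$A\rightarrow B:=\operatorname{Max}\{y\in P\mid L(x,y)\leq_1B\text{ for all }x\in A\},\qquad A\odot B:=\operatorname{Max}\Lambda(A,B);$$ for elements this reads $a\rightarrow b=\operatorname{Max}\{x\in P\mid z\leq b\text{ for all }z\in L(a,x)\}$ and $a\odot b=\operatorname{Max}L(a,b)$. These are non-empty subsets of $P$. An equivalence relation $\Phi$ on $2^P\setminus\{\emptyset\}$ satisfies the substitution property with respect to $\odot$ if for all $x,y\in P$: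 $1\mathrel{\Phi}(x\rightarrow y)$ implies $(x\odot1)\mathrel{\Phi}\big(x\odot(x\rightarrow y)\big)$. It satisfies the substitution property with respect to $\rightarrow$ if for all $x,y,z,u\in P$: - $x\mathrel{\Phi}y$ implies $(x\rightarrow x)\mathrel{\Phi}(x\rightarrow y)$, - $x\mathrel{\Phi}y$ implies $\big((z\rightarrow x)\rightarrow(z\rightarrow x)\big)\mathrel{\Phi}\big((z\rightarrow x)\rightarrow(z\rightarrow y)\big)$, - $x\mathrel{\Phi}y$ implies $\big((x\rightarrow z)\rightarrow(x\rightarrow z)\big)\mathrel{\Phi}\big((x\rightarrow z)\rightarrow(y\rightarrow z)\big)$, - $1\mathrel{\Phi}(x\rightarrow y)$ implies $\big(1\rightarrow(z\rightarrow u)\big)\mathrel{\Phi}\big((x\rightarrow y)\rightarrow(z\rightarrow u)\big)$. *)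

(* Defs.v *)
From mathcomp Require Import all_boot all_order.
From mathcomp Require Import boolp classical_sets.

Set Implicit Arguments.
Unset Strict Implicit.
Unset Printing Implicit Defensive.

Import Order.TTheory.
Local Open Scope order_scope.
Local Open Scope classical_set_scope.

Definition ACC d (T : porderType d) : Prop :=
  ~ exists f : nat -> T, forall n : nat, f n < f n.+1.

Definition Max d (T : porderType d) (A : set T) : set T :=
  [set a | A a /\ ~ exists2 b, A b & a < b].

(* L(a, b), the common lower bounds of a and b. *)
Definition lowers d (T : porderType d) (a b : T) : set T :=
  [set x | x <= a /\ x <= b].

Definition Lambda d (T : porderType d) (A B : set T) : set T :=
  \bigcup_(x in A) \bigcup_(y in B) lowers x y.

Definition le1 d (T : porderType d) (A B : set T) : Prop :=
  forall x, A x -> exists2 y, B y & x <= y.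

(* A -> B; its value at elements is obtained at singletons. *)
Definition arrow d (T : porderType d) (A B : set T) : set T :=
  Max [set y | forall x, A x -> le1 (lowers x y) B].

Definition odot d (T : porderType d) (A B : set T) : set T :=
  Max (Lambda A B).

(* Equivalence relations on 2^T \ {set0}, as relations on [set T] that hold
   only between non-empty sets. *)
Record nonempty_equivalence (T : Type) (Phi : set T -> set T -> Prop) : Prop :=
  NonemptyEquivalence {
    neq_dom : forall A B, Phi A B -> A !=set0 /\ B !=set0;
    neq_refl : forall A, A !=set0 -> Phi A A;
    neq_sym : forall A B, Phi A B -> Phi B A;
    neq_trans : forall A B C, Phi A B -> Phi B C -> Phi A C }.

Definition eqclass (T : Type) (Phi : set T -> set T -> Prop) (A : set T) :
  set (set T) := [set B | Phi A B].

(* Phi `&` P^2, elements being identified with their singletons. *)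
Definition restr_elts (T : Type) (Phi : set T -> set T -> Prop) : set (T * T) :=
  [set ab | Phi [set ab.1] [set ab.2]].

Section Substitution.
Variables (d : Order.disp_t) (T : tbPOrderType d).
Implicit Types Phi : set T -> set T -> Prop.

Local Notation "A ~> B" := (arrow A B) (at level 40, no associativity).
Local Notation "A (.) B" := (odot A B) (at level 40, no associativity).

Definition subst_odot Phi : Prop := forall x y : T,
  Phi [set \top] ([set x] ~> [set y]) ->
  Phi ([set x] (.) [set \top]) ([set x] (.) ([set x] ~> [set y])).

Record subst_arrow Phi : Prop := SubstArrow {
  subst_arrow_diag : forall x y : T, Phi [set x] [set y] ->
    Phi ([set x] ~> [set x]) ([set x] ~> [set y]);
  subst_arrow_right : forall x y z : T, Phi [set x] [set y] ->
    Phi (([set z] ~> [set x]) ~> ([set z] ~> [set x]))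
        (([set z] ~> [set x]) ~> ([set z] ~> [set y]));
  subst_arrow_left : forall x y z : T, Phi [set x] [set y] ->
    Phi (([set x] ~> [set z]) ~> ([set x] ~> [set z]))
        (([set x] ~> [set z]) ~> ([set y] ~> [set z]));
  subst_arrow_top : forall x y z u : T, Phi [set \top] ([set x] ~> [set y]) ->
    Phi ([set \top] ~> ([set z] ~> [set u]))
        (([set x] ~> [set y]) ~> ([set z] ~> [set u])) }.

End Substitution.

(* Under ACC, [arrow] and [odot] are operations on 2^T \ {set0}, so the
   substitution properties only relate sets in the domain of Phi. *)
Lemma Max_nonempty d (T : porderType d) (A : set T) :
  ACC T -> A !=set0 -> Max A !=set0.
Proof.
move=> acc [a Aa]; apply: contrapT => noMax; apply: acc.
have step (x : {x | A x}) : {y : {y | A y} | sval x < sval y}.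
  case: x => x Ax; apply: cid; apply: contrapT => noy; apply: noMax.
  exists x; split=> // -[y Ay xy]; apply: noy.
  by exists (exist _ y Ay).
exists (fun n => sval (iter n (fun x => sval (step x)) (exist _ a Aa))).
by move=> n /=; case: (step _).
Qed.

Lemma arrow_nonempty d (T : tbPOrderType d) (A B : set T) :
  ACC T -> B !=set0 -> arrow A B !=set0.
Proof.
move=> acc [b Bb]; apply: Max_nonempty => //; exists \bot => x _ z [_ z0].
by exists b => //; exact: le_trans z0 (le0x b).
Qed.

Lemma odot_nonempty d (T : tbPOrderType d) (A B : set T) :
  ACC T -> A !=set0 -> B !=set0 -> odot A B !=set0.
Proof.
move=> acc [a Aa] [b Bb]; apply: Max_nonempty => //.
by exists \bot; exists a => //; exists b => //; split; exact: le0x.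
Qed.

(* Main.v *)
(** The class of 1 recovers the restriction to P: x Phi y holds if and only if
    both x -> y and y -> x are in [1]Phi. Left to right this is substitution for
    -> together with x -> x = 1. Right to left, substitution for the product
    gives x = x (.) 1 Phi x (.) (x -> y) = Max L(x, y), which is symmetric in x
    and y, so x and y are both related to this set. *)

Require Import Defs.
From mathcomp Require Import all_boot all_order.
From mathcomp Require Import boolp classical_sets.
Local Open Scope order_scope.
Local Open Scope classical_set_scope.
Set Implicit Arguments.
Unset Strict Implicit.
Import Order.TTheory.

(** A maximal element of the part of [A] above [a] is maximal in all of [A], since any larger
    element of [A] is again above [a]. *)
Lemma Max_above d (T : porderType d) (A : set T) (a : T) :
  ACC T -> A a -> exists2 m, Max A m & a <= m.
Proof.
move=> acc Aa.
have [|m [[Am am] maxm]] := @Max_nonempty d T [set y | A y /\ a <= y] acc.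
  by exists a; split.
exists m => //; split=> // -[b Ab mb]; apply: maxm; exists b => //.
by split=> //; exact: le_trans am (ltW mb).
Qed.

Lemma Max_top d (T : tPOrderType d) (A : set T) :
  A \top -> Max A = [set \top].
Proof.
move=> Atop; apply/seteqP; split=> x /=.
  move=> [Ax maxx]; apply: contrapT => /eqP x_ntop; apply: maxx.
  by exists \top => //; rewrite lt_neqAle x_ntop lex1.
by move=> ->; split=> // -[b _] /lt_geF; rewrite lex1.
Qed.

Lemma lowersC d (T : porderType d) (a b : T) : lowers a b = lowers b a.
Proof. by apply/seteqP; split=> x [xa xb]; split. Qed.

(** Every common lower bound of [x] and 1 is below [x], so 1 is among the candidates. *)
Lemma arrow_refl d (T : tPOrderType d) (x : T) :
  arrow [set x] [set x] = [set \top].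
Proof. by apply: Max_top => _ -> z [zx _]; exists x. Qed.

Lemma odot_topr d (T : tPOrderType d) (x : T) :
  odot [set x] [set \top] = [set x].
Proof.
rewrite /odot /Lambda !bigcup_set1; apply/seteqP; split=> z /=.
  move=> [[zx _] maxz]; apply: contrapT => /eqP z_neq_x; apply: maxz.
  by exists x; [split; rewrite ?lex1 | rewrite lt_neqAle z_neq_x].
move=> ->; split; first by split; rewrite ?lex1.
by move=> [b [bx _] xb]; move: (lt_le_trans xb bx); rewrite ltxx.
Qed.

(** The sets agree before [Max] is taken: the lower bounds that [x] shares with some member of x ->
    y are exactly those it shares with [y]. *)
Lemma odot_arrow d (T : porderType d) (x y : T) :
  ACC T -> odot [set x] (arrow [set x] [set y]) = Max (lowers x y).
Proof.
move=> acc; rewrite /odot /Lambda bigcup_set1; congr (Max _).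
apply/seteqP; split=> z.
  move=> [m [arr _] [zx zm]]; split=> //.
  by have [_ ->] := arr x erefl z (conj zx zm).
move=> [zx zy].
(* The element [y] is itself a candidate for x -> y, so some member [m] of x -> y lies above it,
   whence z <= y <= m. *)
have [|m Mm ym] := @Max_above d T
  [set w | forall v, [set x] v -> le1 (lowers v w) [set y]] y acc.
  by move=> _ -> w [_ wy]; exists y.
by exists m => //; split=> //; exact: le_trans zy ym.
Qed.

Lemma rel_top_arrow d (T : tbPOrderType d) (Phi : set T -> set T -> Prop)
    (x y : T) :
  subst_arrow Phi -> Phi [set x] [set y] ->
  Phi [set \top] (arrow [set x] [set y]).
Proof. by move=> sub /(subst_arrow_diag sub); rewrite arrow_refl. Qed.

Lemma rel_elts_top_arrow d (T : tbPOrderType d) (Phi : set T -> set T -> Prop)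
    (x y : T) :
  ACC T -> nonempty_equivalence Phi -> subst_odot Phi -> subst_arrow Phi ->
  Phi [set x] [set y] <->
  Phi [set \top] (arrow [set x] [set y]) /\
  Phi [set \top] (arrow [set y] [set x]).
Proof.
move=> acc equiv sub_odot sub_arrow; split=> [xy|[]].
  by split; apply: rel_top_arrow => //; exact: (neq_sym equiv).
move=> /sub_odot; rewrite odot_topr odot_arrow // => x_low.
move=> /sub_odot; rewrite odot_topr odot_arrow // lowersC => y_low.
exact: (neq_trans equiv) x_low (neq_sym equiv y_low).
Qed.

Unset Implicit Arguments.
Set Strict Implicit.

Theorem corollary5p6 (d : Order.disp_t) (P : tbPOrderType d)
    (acc : ACC P) (Phi Psi : set P -> set P -> Prop)
    (Phi_equiv : nonempty_equivalence Phi) (Psi_equiv : nonempty_equivalence Psi)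
    (Phi_odot : subst_odot Phi) (Phi_arrow : subst_arrow Phi)
    (Psi_odot : subst_odot Psi) (Psi_arrow : subst_arrow Psi)
    (same_class : eqclass Phi [set \top] = eqclass Psi [set \top]) :
  restr_elts Phi = restr_elts Psi.
Proof.
(* Classes are predicates on sets, so their equality can be evaluated at each [A], here at a -> b
   and b -> a. *)
have same A : Phi [set \top] A = Psi [set \top] A := congr1 (@^~ A) same_class.
apply/funext => -[a b]; apply/propext; rewrite /restr_elts /=.
by rewrite (propext (rel_elts_top_arrow a b acc Phi_equiv Phi_odot Phi_arrow))
  (propext (rel_elts_top_arrow a b acc Psi_equiv Psi_odot Psi_arrow)) !same.
Qed.
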